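(* Let $C\in M_n(\mathbb{C})$ be a nilpotent contraction with $n\le4$, and let $T_1,T_2$ be as defined below. If $T_2(t,\lambda)\equiv0$, then $T_1(t,\mu)\equiv0$. Equivalently, if $Q_C(x,y)\in\mathbb{C}[xy]$ then $P_C(x,y)\in\mathbb{C}[xy]$.
   Context: A contraction is a matrix with $\|C\|\le1$. Let $D=I-C^*C$, $H(t)=\tfrac12(e^{-it}C+e^{it}C^* )$, $K(t)=\tfrac{i}{2}(e^{it}C^*-e^{-it}C)$, $T_1(t,\mu)=\operatorname{tr}((\mu I-H(t))^{-1}K(t))$, $T_2(t,\lambda)=\operatorname{tr}((\lambda^2I-\lambda H(t)-\frac14D)^{-1}\lambda K(t))$, regarded as rational functions of $\mu$, resp. $\lambda$, for each real $t$; $\equiv 0$ means vanishing identically in all variables. $P_C(x,y)=\det(I-xC-yC^* )$, $Q_C(x,y)=\det(I-xC-yC^*-xyD)$, and $\mathbb{C}[xy]$ is the set of polynomials in the product $xy$ alone. *)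

(* Defs.v *)
From HB Require Import structures.
From mathcomp Require Import all_boot all_order all_algebra.
From mathcomp Require Import complex.
From mathcomp Require Import reals trigo.
Set Implicit Arguments.
Unset Strict Implicit.
Unset Printing Implicit Defensive.
Import Order.TTheory GRing.Theory Num.Theory.
Local Open Scope ring_scope.

Section Defs.
Variable R : realType.
Local Notation C := (complex R).

Definition iC : C := Complex 0 1.

Definition expi (t : R) : C := Complex (cos t) (sin t).

Definition adj {n : nat} (A : 'M[C]_n) : 'M[C]_n := (map_mx Num.conj A)^T.

Definition sqnorm {n : nat} (v : 'cV[C]_n) : C := \sum_i `|v i 0| ^+ 2.

Definition contraction {n : nat} (A : 'M[C]_n) : Prop :=
  forall v : 'cV[C]_n, sqnorm (A *m v) <= sqnorm v.

Definition nilpotent {n : nat} (A : 'M[C]_n) : Prop :=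
  exists k : nat, iter k (mulmx A) 1%:M = 0.

Definition Dmx {n : nat} (A : 'M[C]_n) : 'M[C]_n := 1%:M - adj A *m A.

Definition Hmx {n : nat} (A : 'M[C]_n) (t : R) : 'M[C]_n :=
  (2 : C)^-1 *: (expi (- t) *: A + expi t *: adj A).

Definition Kmx {n : nat} (A : 'M[C]_n) (t : R) : 'M[C]_n :=
  (iC / 2) *: (expi t *: adj A - expi (- t) *: A).

(* T_1(t, mu) as a rational function of mu vanishes identically, for all t:
   it vanishes at every mu where (mu I - H(t)) is invertible *)
Definition T1_vanishes {n : nat} (A : 'M[C]_n) : Prop :=
  forall (t : R) (mu : C), (mu%:M - Hmx A t) \in unitmx ->
    \tr (invmx (mu%:M - Hmx A t) *m Kmx A t) = 0.

Definition T2_vanishes {n : nat} (A : 'M[C]_n) : Prop :=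
  forall (t : R) (lam : C),
    ((lam ^+ 2)%:M - lam *: Hmx A t - (4 : C)^-1 *: Dmx A) \in unitmx ->
    \tr (invmx ((lam ^+ 2)%:M - lam *: Hmx A t - (4 : C)^-1 *: Dmx A)
           *m (lam *: Kmx A t)) = 0.
End Defs.

(* Main.v *)
(** Write [B] for the adjoint of [A], [z = e^{it}], [x = s / z] and [y = s z],
    where [s] is half the inverse of [lambda].  Up to nonzero scalars, [T_2] is
    the trace of [N^-1 (z B - z^-1 A)] with [N = (1 - y B)(1 - x A) - xy].
    With [R = (1 - x A)^-1] and [S = (1 - y B)^-1], the Neumann series of
    [N^-1] in powers of [xy R S] shows that, by nilpotency, the two lowest
    coefficients in [s] of this trace are, up to factors, combinations
    [z tr(A B^2) - z^-1 tr(A^2 B)] and [z^2 tr(A B^3) - z^-2 tr(A^3 B)].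
    Their vanishing for all [z] on the unit circle kills the four traces.
    By Cayley-Hamilton, [T_1] is a combination of the traces of [H^i K] with
    [i < n <= 4], and these only involve the same four traces. *)

Require Import Defs.
From HB Require Import structures.
From mathcomp Require Import all_boot all_order all_algebra.
From mathcomp Require Import complex.
From mathcomp Require Import reals trigo.
From mathcomp Require Import ring.
Import Order.TTheory GRing.Theory Num.Theory.
Local Open Scope ring_scope.

(** * Trace expansions of words in two nilpotent resolvents *)

Section TraceExpansions.
Variables (T : comNzRingType) (m : nat).
Implicit Types (A B p q u v w M N : 'M[T]_m.+1) (X a b : T).

Lemma mxtrace_mulrC A B : \tr (A * B) = \tr (B * A).
Proof. exact: mxtrace_mulC. Qed.

(** The conclusion has the shape of the hypothesis, so a long word can be expanded modulo [X ^+ 3]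
    one factor at a time. *)
Lemma mul1DX_trunc X u v w M :
  (exists t, M = 1 + X *: v + X ^+ 2 *: w + X ^+ 3 *: t) ->
  exists t, (1 + X *: u) * M =
    1 + X *: (u + v) + X ^+ 2 *: (w + u * v) + X ^+ 3 *: t.
Proof.
case=> t ->; exists (t + u * w + X *: (u * t)).
rewrite mulrDl mul1r !mulrDr mulr1 -!scalerAl -!scalerAr.
move: (u * v) (u * w) (u * t) 1 => e1 e2 e3 e4.
by apply/matrixP => i j; rewrite !mxE; ring.
Qed.

Lemma mul_trunc2 X (u0 u1 u2 v0 v1 v2 : 'M[T]_m.+1) :
  exists t, (u0 + X *: u1 + X ^+ 2 *: u2) * (v0 + X *: v1 + X ^+ 2 *: v2) =
    u0 * v0 + X *: (u0 * v1 + u1 * v0) + X ^+ 2 *: t.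
Proof.
exists (u0 * v2 + u1 * v1 + u2 * v0 + X *: (u1 * v2 + u2 * v1)
        + X ^+ 2 *: (u2 * v2)).
rewrite !mulrDl !mulrDr -!scalerAl -!scalerAr.
move: (u0 * _) (u1 * _) (u2 * _) (u0 * _) (u1 * _) (u2 * _).
move: (u0 * _) (u1 * _) (u2 * _) => *.
by apply/matrixP => i j; rewrite !mxE; ring.
Qed.

(** The two words exchange the roles of [p] and [q]. Below degree 3 the only traces not assumed zero
    are those of [p * q] and [q * p], which agree and occur equally often on both sides. *)
Lemma mxtrace_alternating3 X p q : \tr p = 0 -> \tr q = 0 ->
    \tr (p * p) = 0 -> \tr (q * q) = 0 ->
  let R := 1 + X *: p in let S := 1 + X *: q in
  \tr (S * (R * S)) - \tr (R * (S * R)) =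
    X ^+ 3 * (\tr (p * (q * q)) - \tr (p * (p * q))).
Proof.
move=> tp tq tpp tqq /=.
rewrite !mulrDl !mulrDr !mulr1 !mul1r -!scalerAl -!scalerAr !linearD !linearZ /=.
rewrite ?linearZ /= tp tq tpp tqq [\tr (q * p)]mxtrace_mulrC.
rewrite [\tr (q * (p * q))]mxtrace_mulrC [\tr (p * (q * p))]mxtrace_mulrC -!mulrA.
rewrite [\tr (q * (p * p))]mxtrace_mulrC -!mulrA.
by ring.
Qed.

(** The cancellation below degree 3 is the same as for words of length 3. Only the order of
    vanishing matters here, so the cofactor [k] stays implicit. *)
Lemma mxtrace_alternating5 X p q : \tr p = 0 -> \tr q = 0 ->
    \tr (p * p) = 0 -> \tr (q * q) = 0 ->
  let R := 1 + X *: p in let S := 1 + X *: q in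
  exists k, \tr (S * (R * (S * (R * S)))) - \tr (R * (S * (R * (S * R)))) =
    X ^+ 3 * k.
Proof.
move=> tp tq tpp tqq R S.
have base u : exists t, 1 + X *: u = 1 + X *: u + X ^+ 2 *: 0 + X ^+ 3 *: t.
  by exists 0; rewrite !scaler0 !addr0.
have [t1 ->] := mul1DX_trunc X q _ _ _ (mul1DX_trunc X p _ _ _ (mul1DX_trunc X q _ _ _
  (mul1DX_trunc X p _ _ _ (base q)))).
have [t2 ->] := mul1DX_trunc X p _ _ _ (mul1DX_trunc X q _ _ _ (mul1DX_trunc X p _ _ _
  (mul1DX_trunc X q _ _ _ (base p)))).
exists (\tr t1 - \tr t2).
rewrite !mulrDr !scalerDr !linearD !linearZ /= linear0.
rewrite tp tq tpp tqq [\tr (q * p)]mxtrace_mulrC.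
by ring.
Qed.

(** For invertible [W] the hypothesis says that [N] is the inverse of [W] minus [X]; the geometric
    series for the inverse of [N] telescopes. *)
Lemma neumann_trunc3 X N W : N * W = 1 - X *: W ->
  N * (W + X *: (W * W) + X ^+ 2 *: (W * (W * W))) =
    1 - X ^+ 3 *: (W * (W * W)).
Proof.
move=> NW; rewrite !mulrDr -!scalerAr !mulrA NW !mulrBl !mul1r -!scalerAl.
move: (W * W * W) (W * W) (1 : 'M[T]_m.+1) => e1 e2 e3.
by apply/matrixP => i j; rewrite !mxE; ring.
Qed.

Section Resolvent.
Variables (A B : 'M[T]_m.+1) (a b X : T).
Hypotheses (ab1 : a * b = 1) (A4 : A ^+ 4 = 0) (B4 : B ^+ 4 = 0).
Hypotheses (trA : forall i, \tr (A ^+ i.+1) = 0)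
           (trB : forall i, \tr (B ^+ i.+1) = 0).

(** When [M ^+ 4 = 0], the inverse of [1 - (c * X) *: M] is a finite geometric series; this is that
    series with the constant term and one factor [X] removed. *)
Let geom (c : T) (M : 'M[T]_m.+1) :=
  c *: M + X *: (c ^+ 2 *: M ^+ 2) + X ^+ 2 *: (c ^+ 3 *: M ^+ 3).

Let geom_inv c M : M ^+ 4 = 0 ->
  (1 - (c * X) *: M) * (1 + X *: geom c M) = 1 /\
  (1 + X *: geom c M) * (1 - (c * X) *: M) = 1.
Proof.
move=> M4; rewrite /geom !mulrDl !mulrDr !mulr1 !mul1r !mulNr !mulrN.
rewrite -!scalerAl -!scalerAr !mulrDl !mulrDr -!scalerAl -!scalerAr.
rewrite -!exprS -!exprSr M4 !scaler0 -expr2.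
split; move: 1 (M ^+ 2) (M ^+ 3) => e1 e2 e3;
  by apply/matrixP => i j; rewrite !mxE; ring.
Qed.

Let tr_geom c M : (forall i, \tr (M ^+ i.+1) = 0) ->
  \tr (geom c M) = 0 /\ \tr (geom c M * geom c M) = 0.
Proof.
move=> trM; rewrite /geom.
have trM1 : \tr M = 0 by rewrite -(expr1 M) trM.
rewrite !mulrDl !mulrDr -!scalerAl -!scalerAr -!exprD -!exprS -!exprSr.
by rewrite !linearD !linearZ /= !trM trM1 !mulr0 !addr0.
Qed.

(* [S (y B) = S - 1] and [(x A) R = R - 1], so each Neumann term contributes a
   difference of traces of the alternating words [S R ... S] and [R S ... R]. *)
Lemma pencil_trace_expansion :
  let N := (1 - (b * X) *: B) * (1 - (a * X) *: A) - (X ^+ 2) *: 1 in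
  exists G E k,
    N * G = 1 - X ^+ 6 *: E /\
    X * \tr (G * (b *: B - a *: A)) =
      X ^+ 5 * (b * \tr (A * B ^+ 2) - a * \tr (A ^+ 2 * B) +
        X * (2 * (b ^+ 2 * \tr (A * B ^+ 3) - a ^+ 2 * \tr (A ^+ 3 * B)))
        + X ^+ 2 * k).
Proof.
move=> N.
have [VR _] := geom_inv a A A4; have [US SU] := geom_inv b B B4.
have [tp tpp] := tr_geom a A trA; have [tq tqq] := tr_geom b B trB.
set p := geom a A in VR tp tpp; set q := geom b B in US SU tq tqq.
set R := 1 + X *: p in VR; set S := 1 + X *: q in US SU.
set U := 1 - (b * X) *: B in US SU; set V := 1 - (a * X) *: A in VR.
pose W := R * S.
have NW : N * W = 1 - X ^+ 2 *: W.
  by rewrite /N /W mulrBl mulrA -(mulrA U) VR mulr1 US -scalerAl mul1r.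
exists (W + X ^+ 2 *: (W * W) + X ^+ 4 *: (W * (W * W))), (W * (W * W)).
have [k5 Ek5] := mxtrace_alternating5 X p q tp tq tpp tqq.
have Ek3 := mxtrace_alternating3 X p q tp tq tpp tqq.
rewrite /= -/R -/S in Ek3 Ek5.
have SB : S * (b * X *: B) = S - 1 by rewrite -SU /U mulrBr mulr1 opprB addrC subrK.
have AR : (a * X *: A) * R = R - 1 by rewrite -VR /V mulrBl mul1r opprB addrC subrK.
have trZ Y Y' : R * Y = Y' * S ->
    X * \tr (R * Y * (b *: B - a *: A)) = \tr Y - \tr Y'.
  move=> RY.
  have -> : X * \tr (R * Y * (b *: B - a *: A)) =
      \tr (Y' * (S * (b * X *: B))) - \tr (a * X *: A * R * Y).
    rewrite mulrA -RY -(mulrA (_ *: A)) [\tr (_ *: A * _)]mxtrace_mulrC.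
    by rewrite mulrBr linearB /= -!scalerAr !linearZ /=; ring.
  by rewrite SB AR mulrBr mulrBl mulr1 mul1r !linearB /= RY; ring.
have [t1 Eqq] := mul_trunc2 X (b *: B) (b ^+ 2 *: B ^+ 2) (b ^+ 3 *: B ^+ 3)
                   (b *: B) (b ^+ 2 *: B ^+ 2) (b ^+ 3 *: B ^+ 3).
have [t2 Epqq] := mul_trunc2 X (a *: A) (a ^+ 2 *: A ^+ 2) (a ^+ 3 *: A ^+ 3)
  (b *: B * (b *: B)) (b *: B * (b ^+ 2 *: B ^+ 2) + b ^+ 2 *: B ^+ 2 * (b *: B)) t1.
have [t3 Epq] := mul_trunc2 X (a *: A) (a ^+ 2 *: A ^+ 2) (a ^+ 3 *: A ^+ 3)
                   (b *: B) (b ^+ 2 *: B ^+ 2) (b ^+ 3 *: B ^+ 3).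
have [t4 Eppq] := mul_trunc2 X (a *: A) (a ^+ 2 *: A ^+ 2) (a ^+ 3 *: A ^+ 3)
  (a *: A * (b *: B)) (a *: A * (b ^+ 2 *: B ^+ 2) + a ^+ 2 *: A ^+ 2 * (b *: B)) t3.
exists (\tr t2 - \tr t4 + k5); split.
  by have := neumann_trunc3 _ _ _ NW; rewrite -!exprM.
(* In degree 1 both sides of the difference contain the trace of [A ^+ 2 * B ^+ 2] with coefficient
   [a ^+ 2 * b ^+ 2], and it cancels. The other coefficients simplify by [a * b = 1]. *)
have Etr : \tr (p * (q * q)) - \tr (p * (p * q)) =
    b * \tr (A * B ^+ 2) - a * \tr (A ^+ 2 * B) +
    X * (2 * (b ^+ 2 * \tr (A * B ^+ 3) - a ^+ 2 * \tr (A ^+ 3 * B)))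
    + X ^+ 2 * (\tr t2 - \tr t4).
  rewrite /p /q /geom Eqq Epq Epqq Eppq !mulrDr -!scalerAl -!scalerAr.
  rewrite !(exprSr _ 2) !expr2 !mulrA.
  rewrite !linearD !linearZ /=.
  by ring: ab1.
set L := b *: B - a *: A in trZ *.
(* The first Neumann term vanishes because [R] and [S] have equal trace; the next two start in
   degrees 5 and 7, once their factors [X ^+ 2] and [X ^+ 4] are counted. *)
have EW1 : X * \tr (W * L) = 0.
  have trR : \tr R = \tr (1 : 'M[T]_m.+1) by rewrite mxtraceD mxtraceZ tp mulr0 addr0.
  have trS : \tr S = \tr (1 : 'M[T]_m.+1) by rewrite mxtraceD mxtraceZ tq mulr0 addr0.
  by rewrite (trZ S R) // trR trS subrr.
have EW2 : X * \tr (W * W * L) = X ^+ 3 * (\tr (p * (q * q)) - \tr (p * (p * q))).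
  by rewrite -Ek3 -trZ /W !mulrA.
have EW3 : X * \tr (W * (W * W) * L) = X ^+ 3 * k5.
  by rewrite -Ek5 -trZ /W !mulrA.
have -> : X * \tr ((W + X ^+ 2 *: (W * W) + X ^+ 4 *: (W * (W * W))) * L) =
    X * \tr (W * L) + X ^+ 2 * (X * \tr (W * W * L))
    + X ^+ 4 * (X * \tr (W * (W * W) * L)).
  by rewrite !mulrDl -!scalerAl !linearD !linearZ /=; ring.
by rewrite EW1 EW2 EW3 Etr; ring.
Qed.
End Resolvent.
End TraceExpansions.

(** * Characteristic polynomial and traces of nilpotent matrices *)

Section NilpotentMatrix.
Variables (F : closedFieldType) (m : nat).
Implicit Type A : 'M[F]_m.+1.

(** The characteristic polynomial splits, and each root [z] is an eigenvalue, so [z ^+ k] is an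
    eigenvalue of [A ^+ k = 0]. *)
Lemma char_poly_nilpotent A k : A ^+ k = 0 -> char_poly A = 'X^(m.+1).
Proof.
move=> Ak0; have [r] := closed_field_poly_normal (char_poly A).
have /monicP-> := char_poly_monic A; rewrite scale1r => Er.
have r0 z : z \in r -> z = 0.
  move=> zr; have : eigenvalue A z.
    by rewrite eigenvalue_root_char Er root_prod_XsubC.
  case/eigenvalueP=> v vA v0.
  have vAk j : v *m A ^+ j = z ^+ j *: v.
    elim: j => [|j IHj]; first by rewrite !expr0 scale1r mulmx1.
    by rewrite exprSr mulmxA IHj -scalemxAl vA scalerA -exprSr.
  have /esym/eqP := vAk k; rewrite Ak0 mulmx0 scaler_eq0 (negPf v0) orbF.
  by rewrite expf_eq0 => /andP[_ /eqP].
have Esz : size r = m.+1.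
  by apply/succn_inj; rewrite -(size_prod_XsubC r id) -Er size_char_poly.
rewrite Er (eq_big_seq (fun=> 'X)) => [|z /r0->]; last by rewrite subr0.
by rewrite big_const_seq count_predT Esz iter_mulr_1.
Qed.

Lemma nilpotent_exp A k : A ^+ k = 0 -> A ^+ m.+1 = 0.
Proof.
move=> Ak0; have := Cayley_Hamilton A; rewrite (char_poly_nilpotent _ _ Ak0).
by rewrite rmorphXn /= horner_mx_X.
Qed.

Lemma mxtrace_nilpotent A k : A ^+ k = 0 -> \tr A = 0.
Proof.
move=> Ak0; apply/eqP; rewrite -oppr_eq0 -char_poly_trace //.
by rewrite (char_poly_nilpotent _ _ Ak0) coefXn /= ltn_eqF.
Qed.

Lemma mxtrace_nilpotent_exp A k i : A ^+ k = 0 -> \tr (A ^+ i.+1) = 0.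
Proof.
by move=> Ak0; apply: (@mxtrace_nilpotent _ k); rewrite -exprM mulnC exprM Ak0 expr0n.
Qed.

End NilpotentMatrix.

(** * From a vanishing resolvent trace to its lowest coefficients *)

Lemma poly_horner_eq0 (F : numDomainType) (p : {poly F}) :
  (forall s, p.[s] = 0) -> p = 0.
Proof.
move=> p0; apply: (@roots_geq_poly_eq0 _ _ [seq i%:R | i <- iota 0 (size p)]).
- by apply/allP => s _; apply/rootP.
- by rewrite map_inj_uniq ?iota_uniq // => i j /eqP; rewrite eqr_nat => /eqP.
- by rewrite size_map size_iota.
Qed.

Section PencilTrace.
Variables (F : numFieldType) (m : nat) (A B : 'M[F]_m.+1) (a b : F).
Hypotheses (ab1 : a * b = 1) (A4 : A ^+ 4 = 0) (B4 : B ^+ 4 = 0).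
Hypotheses (trA : forall i, \tr (A ^+ i.+1) = 0)
           (trB : forall i, \tr (B ^+ i.+1) = 0).

Let pencil s := (1 - (b * s) *: B) * (1 - (a * s) *: A) - (s ^+ 2) *: 1.

Hypothesis resolvent0 : forall s, s != 0 -> pencil s \in unitmx ->
  \tr (invmx (pencil s) *m (b *: B - a *: A)) = 0.

(** The expansion is instantiated over polynomials with [X] the indeterminate. Its error term has
    order 6, which leaves the two lowest coefficients of the trace exact. *)
Lemma pencil_trace_coefs :
  b * \tr (A * B ^+ 2) - a * \tr (A ^+ 2 * B) = 0 /\
  b ^+ 2 * \tr (A * B ^+ 3) - a ^+ 2 * \tr (A ^+ 3 * B) = 0.
Proof.
pose f : {rmorphism F -> {poly F}} := polyC.
pose A' := map_mx f A; pose B' := map_mx f B.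
have mapX (M : 'M[F]_m.+1) i : map_mx f M ^+ i = map_mx f (M ^+ i).
  by rewrite -[RHS]/((map_mx f) _) rmorphXn.
have mapM (M M' : 'M[F]_m.+1) : map_mx f M * map_mx f M' = map_mx f (M * M').
  by rewrite -[RHS]/((map_mx f) _) rmorphM.
have [|||i|i|] := @pencil_trace_expansion _ _ A' B' a%:P b%:P 'X.
- by rewrite -polyCM ab1.
- by rewrite mapX A4 map_mx0.
- by rewrite mapX B4 map_mx0.
- by rewrite mapX trace_map_mx trA rmorph0.
- by rewrite mapX trace_map_mx trB rmorph0.
set N := (_ - _); set L := (_ *: B' - _) => G [E [k [NG XtrG]]].
have mapXM i j : \tr (A' ^+ i * B' ^+ j) = (\tr (A ^+ i * B ^+ j))%:P.
  by rewrite !mapX mapM trace_map_mx.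
have evalC s (M : 'M[F]_m.+1) : map_mx (horner_eval s) (map_mx f M) = M.
  by apply/matrixP => i j; rewrite !mxE /= horner_evalE hornerC.
have evalN s : map_mx (horner_eval s) N = pencil s.
  rewrite /N /pencil !(rmorphB, rmorphM) /=.
  by rewrite !map_mxZ !rmorph1 !evalC /= !horner_evalE !hornerE.
have evalL s : map_mx (horner_eval s) L = b *: B - a *: A.
  by rewrite /L !rmorphB /= !map_mxZ !evalC /= !horner_evalE !hornerE.
have detN0 : (\det N).[0] = 1.
  rewrite -horner_evalE -det_map_mx evalN /pencil !mulr0 expr0n /= !scale0r.
  by rewrite !subr0 mulr1 det1.
have nzN : \det N != 0.
  by apply: contra_eq_neq detN0 => ->; rewrite horner0 eq_sym oner_eq0.
(* The adjugate replaces the inverse to stay within polynomials. The factor [\det N * 'X] covers the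
   values of [s] excluded by [resolvent0], and it cancels since it is nonzero. *)
have adjL0 : \tr (\adj N *m L) = 0.
  have : \tr (\adj N *m L) * (\det N * 'X) = 0.
    apply: poly_horner_eq0 => s; rewrite !hornerM hornerX.
    have [->|s0] := eqVneq s 0; first by rewrite !mulr0.
    have [->|dN0] := eqVneq (\det N).[s] 0; first by rewrite mul0r mulr0.
    have uN : pencil s \in unitmx.
      by rewrite unitmxE -evalN det_map_mx /= horner_evalE unitfE.
    have := resolvent0 s s0 uN; rewrite /invmx uN -scalemxAl mxtraceZ => /eqP.
    rewrite mulf_eq0 invr_eq0 -{1}evalN det_map_mx /= horner_evalE (negPf dN0) /=.
    rewrite -evalN -map_mx_adj -(evalL s) -map_mxM trace_map_mx /= horner_evalE.
    by move=> /eqP ->; rewrite mul0r.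
  by move/eqP; rewrite !mulf_eq0 (negPf nzN) polyX_eq0 !orbF => /eqP.
clearbody L N.
have detG : \det N * \tr (G *m L) = - ('X ^+ 6 * \tr (\adj N *m E *m L)).
  have : \adj N *m (N *m G) *m L = \adj N *m (1%:M - 'X ^+ 6 *: E) *m L.
    by congr (_ *m _ *m _).
  rewrite mulmxA mul_adj_mx mul_scalar_mx [\adj N *m (_ - _)]mulmxBr mulmx1.
  rewrite mulmxBl -[\adj N *m (_ *: E)]scalemxAr.
  rewrite -!scalemxAl => /(congr1 mxtrace).
  by rewrite mxtraceZ linearB /= adjL0 mxtraceZ sub0r.
set k' := \tr (_ *m _ *m _) in detG.
have := XtrG.
rewrite (mapXM 1 2)%N (mapXM 1 3)%N (mapXM 2 1)%N (mapXM 3 1)%N !expr1.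
set c0 := (X in X + _ + _); set c1 := (X in _ + 'X * X + _) => Ec.
(* After multiplication by ['X], order 7 on the right meets ['X ^+ 5] on the left. As [\det N] is 1
   at 0, the constants [c0] and then [c1] can be read off by evaluating at 0. *)
have Edet : \det N * (c0 + 'X * c1 + 'X ^+ 2 * k) = - ('X ^+ 2 * k').
  have X5 : ('X : {poly F}) ^+ 5 != 0 by rewrite expf_neq0 // polyX_eq0.
  apply: (mulfI X5); rewrite mulrCA -Ec mulrCA detG; ring.
have c00 : c0.[0] = 0.
  have /(congr1 (horner^~ 0)) := Edet.
  by rewrite /= !hornerE detN0 !expr0n /= !mul0r !addr0 oppr0 mul1r.
have Ec0 : c0 = 0.
  move: c00; rewrite /c0 -!polyCM -polyCB hornerC => ->; exact: rmorph0.
have c10 : c1.[0] = 0.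
  have X0 : ('X : {poly F}) != 0 by rewrite polyX_eq0.
  have /(congr1 (horner^~ 0)) : \det N * (c1 + 'X * k) = - ('X * k').
    apply: (mulfI X0); transitivity (- ('X ^+ 2 * k')); last by ring.
    by rewrite -Edet Ec0; ring.
  rewrite /= hornerM detN0 mul1r hornerD hornerN ![('X * _).[0]]hornerM.
  by rewrite !hornerX !mul0r oppr0 addr0.
split; first by move: c00; rewrite /c0 -!polyCM -polyCB hornerC.
move: c10; rewrite /c1 -!polyC_exp -!polyCM -polyCB hornerM hornerC => /eqP.
by rewrite mulf_eq0 -polyC_natr hornerC pnatr_eq0 /= => /eqP.
Qed.
End PencilTrace.

(** * Reduction of the first trace to finitely many words *)

Lemma mxtrace_pow_sum_mul_diff (T : comNzRingType) m (P Q : 'M[T]_m.+1) i :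
    (forall j, \tr (P ^+ j.+1) = 0) -> (forall j, \tr (Q ^+ j.+1) = 0) ->
    \tr (P ^+ 2 * Q) = 0 -> \tr (P * Q ^+ 2) = 0 ->
    \tr (P ^+ 3 * Q) = 0 -> \tr (P * Q ^+ 3) = 0 -> (i < 4)%N ->
  \tr ((P + Q) ^+ i * (Q - P)) = 0.
Proof.
move=> trP trQ; rewrite !(exprSr _ 2) !expr2 !mulrA => PPQ PQQ PPPQ PQQQ.
have rot (M N : 'M[T]_m.+1) c : \tr (M * N) = c -> \tr (N * M) = c.
  by rewrite mxtrace_mulrC.
have P1 := trP 0; have P2 := trP 1; have P3 := trP 2; have P4 := trP 3.
have Q1 := trQ 0; have Q2 := trQ 1; have Q3 := trQ 2; have Q4 := trQ 3.
rewrite ?expr1 ?exprSr ?expr0 ?mul1r in P1 P2 P3 P4 Q1 Q2 Q3 Q4.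
have QPP := rot _ _ _ PPQ; have QPQ := rot _ _ _ PQQ.
have QPPP := rot _ _ _ PPPQ; have QPQQ := rot _ _ _ PQQQ.
rewrite !mulrA in QPP QPQ QPPP QPQQ.
have PQP := rot _ _ _ QPP; have QQP := rot _ _ _ QPQ.
have PQPP := rot _ _ _ QPPP; have QQPQ := rot _ _ _ QPQQ.
rewrite !mulrA in PQP QQP PQPP QQPQ.
have PPQP := rot _ _ _ PQPP; have QQQP := rot _ _ _ QQPQ.
rewrite !mulrA in PPQP QQQP.
(* The words with two letters of each kind remain. Their sign is given by the last letter, and each
   class under cyclic rotation contains as many words ending in [Q] as in [P], so they cancel. *)
have QQPP : \tr (Q * Q * P * P) = \tr (P * P * Q * Q).
  by rewrite -mulrA mxtrace_mulrC !mulrA.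
have QPPQ : \tr (Q * P * P * Q) = \tr (P * P * Q * Q).
  by rewrite -!mulrA mxtrace_mulrC !mulrA.
have PQQP : \tr (P * Q * Q * P) = \tr (P * P * Q * Q).
  by rewrite mxtrace_mulrC !mulrA.
have QPQP : \tr (Q * P * Q * P) = \tr (P * Q * P * Q).
  by rewrite mxtrace_mulrC !mulrA.
case: i => [|[|[|[|//]]]] _; rewrite ?exprSr expr0 !mul1r.
- by rewrite linearB /= P1 Q1 subrr.
- rewrite !mulrDl !mulrDr !mulrN !linearD !linearN /=.
  by rewrite P2 Q2 [\tr (Q * P)]mxtrace_mulrC; ring.
- rewrite !mulrDl !mulrDr !mulrN !mulrDl ?opprD !linearD !linearN /=.
  by rewrite PPQ PQQ P3 Q3 QPP QPQ PQP QQP; ring.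
- rewrite !mulrDl !mulrDr !mulrN !mulrDl ?opprD !linearD !linearN /=.
  rewrite P4 Q4 PPPQ PQQQ QPPP QPQQ PQPP QQPQ PPQP QQQP.
  by rewrite QQPP QPPQ PQQP QPQP; ring.
Qed.

(** Multiplying the Cayley-Hamilton relation by the inverse of [M] writes that inverse, times the
    constant coefficient, as a combination of the powers of [M] up to [m]. The constant coefficient
    is the determinant up to sign, hence nonzero. *)
Lemma mxtrace_invmx_eq0 (F : fieldType) m (M K : 'M[F]_m.+1) :
    M \in unitmx -> (forall i, (i <= m)%N -> \tr (M ^+ i *m K) = 0) ->
  \tr (invmx M *m K) = 0.
Proof.
move=> uM trMK.
have := Cayley_Hamilton M; rewrite -[char_poly M]coefK poly_def size_char_poly.
rewrite linear_sum big_ord_recl /= => /(congr1 (fun Z => \tr (invmx M *m Z *m K))).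
rewrite mulmx0 mul0mx linear0 expr0 linearZ /= rmorph1 mulmxDr mulmxDl linearD /=.
rewrite mulmx_sumr mulmx_suml linear_sum /= big1 => [|i _]; last first.
  rewrite linearZ /= rmorphXn /= horner_mx_X exprS -scalemxAr -scalemxAl.
  by rewrite mulmxA mulVmx // mul1mx linearZ /= trMK ?mulr0 // -ltnS.
rewrite addr0 -scalemxAr -scalemxAl mulmx1 linearZ /= => /eqP.
rewrite char_poly_det mulf_eq0 mulf_eq0 signr_eq0 /=.
by move: uM; rewrite unitmxE unitfE => /negPf-> /eqP.
Qed.

Lemma mxtrace_shift_exp (T : comNzRingType) m (H K : 'M[T]_m.+1) c d :
    (forall i, (i < d)%N -> \tr (H ^+ i * K) = 0) ->
  forall i, (i < d)%N -> \tr ((c%:M - H) ^+ i * K) = 0.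
Proof.
move=> trHK i id_.
(* Peeling off one factor [c%:M - H] leaves either a scalar or one more [H] next to [K], so the
   induction must carry [H ^+ j]. *)
suff: forall i j, (i + j < d)%N -> \tr ((c%:M - H) ^+ i * (H ^+ j * K)) = 0.
  by move=> /(_ i 0%N); rewrite addn0 expr0 mul1r; apply.
elim=> {i id_} [|i IHi] j ikd; first by rewrite expr0 mul1r trHK.
rewrite exprSr -mulrA mulrBl.
rewrite [H * _]mulrA -exprS mulrBr [c%:M * _]mul_scalar_mx -scalerAr.
rewrite linearB linearZ /= !IHi ?mulr0 ?subr0 ?addnS //.
by apply: leq_trans ikd; rewrite addSn.
Qed.

Lemma iter_mulmx_exp (T : comNzRingType) m (A : 'M[T]_m.+1) k :
  iter k (mulmx A) 1%:M = A ^+ k.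
Proof. by elim: k => //= k ->; rewrite exprS. Qed.

(** * Adjoints and phases on the unit circle *)

Section Rotation.
Variable R : realType.
Local Notation C := (complex R).

Lemma adj_exp m (A : 'M[C]_m.+1) k : adj A ^+ k = adj (A ^+ k).
Proof.
elim: k => [|k IHk]; first by rewrite !expr0 /adj map_mx1 trmx1.
by rewrite exprS IHk exprSr /adj map_mxM trmx_mul.
Qed.

Lemma expiNM (t : R) : expi (- t) * expi t = 1.
Proof.
rewrite /expi cosN sinN; simpc; apply/eqP; rewrite eq_complex /=.
by rewrite -!expr2 cos2Dsin2 [sin t * _]mulrC subrr !eqxx.
Qed.

Lemma expi0 : expi (0 : R) = 1.
Proof. by rewrite /expi cos0 sin0. Qed.

Lemma expi_pihalf : expi (pi / 2 : R) = iC R.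
Proof. by rewrite /expi cos_pihalf sin_pihalf. Qed.

Lemma expiD (s t : R) : expi (s + t) = expi s * expi t.
Proof. by rewrite /expi cosD sinD; simpc; rewrite [sin s * _ + _]addrC. Qed.

Lemma expiMn (t : R) k : expi (t *+ k) = expi t ^+ k.
Proof. by elim: k => [|k IHk]; rewrite ?mulr0n ?expi0 // mulrS expiD IHk exprS. Qed.

(** Two angles suffice: [t = 0] gives [p = q], and the angle at which [expi t ^+ k.+1] equals [iC]
    gives [p + q = 0]. *)
Lemma rotation_coefs_eq0 k (p q : C) :
    (forall t : R, expi t ^+ k.+1 * p - expi (- t) ^+ k.+1 * q = 0) ->
  p = 0 /\ q = 0.
Proof.
move=> E.
have := E 0; rewrite oppr0 expi0 !expr1n !mul1r => /subr0_eq pq.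
have := E (pi / 2 / k.+1%:R); rewrite -!expiMn mulNrn.
rewrite -[_ *+ _]mulr_natr divfK ?pnatr_eq0 //.
have -> : expi (- (pi / 2)) = - expi (pi / 2 : R).
  by rewrite /expi cosN sinN cos_pihalf; apply/eqP; rewrite eq_complex /= oppr0 !eqxx.
rewrite mulNr opprK -mulrDr pq -mulr2n => /eqP.
rewrite mulf_eq0 mulrn_eq0 /= expi_pihalf eq_complex /= oner_eq0 andbF /=.
by move=> /eqP.
Qed.
End Rotation.

(** * The second trace as a pencil trace, and the conclusion *)

Lemma T2_pencil (R : realType) m (A : 'M[complex R]_m.+1) (t : R) s :
  T2_vanishes A -> s != 0 ->
  let N := (1 - (expi t * s) *: adj A) * (1 - (expi (- t) * s) *: A) - s ^+ 2 *: 1 in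
  N \in unitmx -> \tr (invmx N *m (expi t *: adj A - expi (- t) *: A)) = 0.
Proof.
move=> T2 s0 N uN.
(* With this value [lam ^+ 2 * s ^+ 2] is one quarter, so the terms of [N] in [s ^+ 2] produce the
   quarter of [Dmx A]. The phases cancel in the product of the two factors, whose order yields
   [adj A * A]. *)
pose lam := (2 * s)^-1.
have n2 : (2 : complex R) != 0 by rewrite pnatr_eq0.
have lam0 : lam != 0 by rewrite invr_eq0 mulf_neq0.
have EN : (lam ^+ 2)%:M - lam *: Hmx A t - 4^-1 *: Dmx A = lam ^+ 2 *: N.
  rewrite /N /Hmx /Dmx mulrBl !mulrBr !mul1r mulr1 -scalerAl -scalerAr.
  rewrite -[(lam ^+ 2)%:M]scalemx1 -[adj A *m A]/(adj A * A) -[1%:M]/1.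
  move: (adj A * A) (adj A) 1 => e1 e2 e3.
  apply/matrixP => i j; rewrite !mxE /lam.
  have -> : (4 : complex R) = 2 * 2 by rewrite -natrM.
  set S := \sum_j0 _.
  have -> : expi t * s * (expi (- t) * s * S) = s ^+ 2 * S.
    by transitivity (expi (- t) * expi t * (s ^+ 2 * S)); [ring | rewrite expiNM mul1r].
  by field; rewrite s0.
have lam2 : lam ^+ 2 \is a GRing.unit by rewrite unitfE expf_neq0.
have := T2 t lam; rewrite EN unitmxZ // => /(_ uN).
rewrite invmxZ ?unitmxZ // /Kmx scalerA -scalemxAl -scalemxAr !linearZ /= => /eqP.
have iC0 : iC R != 0 by rewrite eq_complex /= oner_eq0 andbF.
rewrite !mulf_eq0 !invr_eq0 expf_eq0 /= mulf_eq0 (negPf n2) (negPf s0) (negPf iC0).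
by rewrite (negPf lam0) /= => /eqP.
Qed.

Theorem mainTheorem10 (R : realType) (n : nat) (A : 'M[complex R]_n) :
  (n <= 4)%N -> contraction A -> nilpotent A ->
  T2_vanishes A -> T1_vanishes A.
Proof.
case: n A => [|m] A n4 _ [k]; first by move=> _ _ t mu _; apply: big_ord0.
rewrite iter_mulmx_exp => Ak T2 t mu uM.
have Bk : adj A ^+ k = 0 by rewrite adj_exp Ak /adj map_mx0 trmx0.
have exp4 (M : 'M[complex R]_m.+1) : M ^+ k = 0 -> M ^+ 4 = 0.
  by move=> Mk; rewrite -(subnKC n4) exprD (nilpotent_exp _ _ _ _ Mk) mul0r.
have trA i := mxtrace_nilpotent_exp _ _ _ _ i Ak.
have trB i := mxtrace_nilpotent_exp _ _ _ _ i Bk.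
have coefs (u : R) := pencil_trace_coefs _ _ _ _ _ _ (expiNM _ u) (exp4 _ Ak)
  (exp4 _ Bk) trA trB (fun s => T2_pencil _ _ _ u s T2).
(* The coefficients vanish at every angle; separating opposite phases isolates each trace, at
   frequency 1 here and at frequency 2 for the next pair. *)
have [ABB AAB] : \tr (A * adj A ^+ 2) = 0 /\ \tr (A ^+ 2 * adj A) = 0.
  apply: (@rotation_coefs_eq0 _ 0%N) => u; rewrite !expr1; exact: (coefs u).1.
have [ABBB AAAB] : \tr (A * adj A ^+ 3) = 0 /\ \tr (A ^+ 3 * adj A) = 0.
  apply: (@rotation_coefs_eq0 _ 1%N) => u; exact: (coefs u).2.
apply: (mxtrace_invmx_eq0 _ _ _ _ uM) => i im.
have i4 : (i < 4)%N by apply: leq_trans n4.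
apply: (@mxtrace_shift_exp _ _ _ _ mu 4) i4 => {im uM}i i4.
rewrite /Hmx /Kmx exprZn -scalerAl -scalerAr !mxtraceZ.
have trZ (c d : complex R) j l : \tr (A ^+ j * adj A ^+ l) = 0 ->
    \tr ((c *: A) ^+ j * (d *: adj A) ^+ l) = 0.
  by move=> tr0; rewrite !exprZn -scalerAl -scalerAr !mxtraceZ tr0 !mulr0.
(* Up to scalars, [Hmx] and [Kmx] are the sum and the difference of the phase-twisted [A] and
   [adj A]; the twist only rescales the traces that have to vanish. *)
suff -> : \tr ((expi (- t) *: A + expi t *: adj A) ^+ i *
                (expi t *: adj A - expi (- t) *: A)) = 0 by rewrite !mulr0.
apply: mxtrace_pow_sum_mul_diff i4.
- by move=> j; rewrite exprZn mxtraceZ trA mulr0.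
- by move=> j; rewrite exprZn mxtraceZ trB mulr0.
- by rewrite -[X in _ * X]expr1 trZ // expr1.
- by rewrite -[X in X * _]expr1 trZ // expr1.
- by rewrite -[X in _ * X]expr1 trZ // expr1.
- by rewrite -[X in X * _]expr1 trZ // expr1.
Qed.
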